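(* Let $p$ be a rational prime, let $x\in(0,\infty]$, and let $(\alpha_1,\alpha_2,\ldots)\in\tau^{-1}(p^2)$ be such that $M_x(p^2)=M_x(\alpha_1,\alpha_2,\ldots)$. (i) If $x\cdot\left(\log\log(p^2)-\log\log 2\right)<\log 2$, then there is precisely one index $n$ for which $\alpha_n$ is not a root of unity. (ii) If $x>1$, then there are at least two indices $n$ for which $\alpha_n$ is not a root of unity.
   Context: $\overline{\mathbb Q}^\times$ is the multiplicative group of non-zero algebraic numbers. For $f(z)=a\prod_{n=1}^N(z-\alpha_n)\in\mathbb C[z]$ with $a\neq 0$, the (logarithmic) Mahler measure is $M(f)=\log|a|+\sum_{n=1}^N\log^+|\alpha_n|$, where $\log^+ t=\max\{\log t,0\}$ (and $\log^+0=0$). For $\alpha\in\overline{\mathbb Q}^\times$, $M(\alpha)$ denotes the Mahler measure of the minimal polynomial of $\alpha$ over $\mathbb Z$ (primitive, irreducible, with integer coefficients). $\mathcal X(\overline{\mathbb Q}^\times)$ is the set of sequences $(\alpha_1,\alpha_2,\ldots)$ in $\overline{\mathbb Q}^\times$ with $\alpha_n=1$ for all but finitely many $n$, and $\tau:\mathcal X(\overline{\mathbb Q}^\times)\to\overline{\mathbb Q}^\times$ is $\tau(\alpha_1,\alpha_2,\ldots)=\prod_{n=1}^\infty\alpha_n$. For $x\in(0,\infty]$ and $(\alpha_1,\alpha_2,\ldots)\in\mathcal X(\overline{\mathbb Q}^\times)$, put $M_x(\alpha_1,\alpha_2,\ldots)=\left(\sum_{n=1}^\infty M(\alpha_n)^x\right)^{1/x}$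 if $x<\infty$, and $M_\infty(\alpha_1,\alpha_2,\ldots)=\max_{n\ge1}M(\alpha_n)$. For $\alpha\in\overline{\mathbb Q}^\times$, $M_x(\alpha)=\inf\{M_x(\bar\alpha):\bar\alpha\in\tau^{-1}(\alpha)\}$. *)

(* Defs.v *)
From mathcomp Require Import all_boot all_order all_algebra.
From mathcomp Require Import all_classical all_reals all_analysis.
From mathcomp Require Import complex.

Set Implicit Arguments.
Unset Strict Implicit.
Unset Printing Implicit Defensive.

Import Order.TTheory GRing.Theory Num.Theory.

Local Open Scope classical_set_scope.
Local Open Scope ring_scope.
Local Open Scope complex_scope.

(* The complex numbers are R[i] for R : realType, and the algebraic numbers are
   taken inside R[i]. *)

Definition Qbar_units (R : realType) : set R[i] :=
  [set z | z != 0 /\ algebraicOver (ratr : rat -> R[i]) z].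

Definition is_root_of_unity (R : realType) (z : R[i]) : Prop :=
  exists2 n : nat, (0 < n)%N & n.-unity_root z.

(* ln takes the value 0 at 0, so that log_plus 0 = 0. *)
Definition log_plus (R : realType) (t : R) : R := Num.max (ln t) 0.

(* The roots of f, listed with multiplicity. *)
Definition croots (R : realType) (f : {poly R[i]}) : seq R[i] :=
  sval (closed_field_poly_normal f).

Definition mahler_poly (R : realType) (f : {poly R[i]}) : R :=
  ln (ComplexField.Normc.normc (lead_coef f)) +
  \sum_(z <- croots f) log_plus (ComplexField.Normc.normc z).

(* zcontents f carries the sign of the leading coefficient, so zcontents f = 1
   says that f is primitive with positive leading coefficient; this fixes the
   sign of the minimal polynomial. For primitive f, irreducibility over Z is
   irreducibility over Q (Gauss); irreducible_poly is not used over int itself,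
   where it is based on pseudo-division. *)
Definition is_int_minpoly (R : realType) (z : R[i]) (f : {poly int}) : Prop :=
  [/\ zcontents f = 1,
      irreducible_poly (map_poly intr f : {poly rat}) &
      root (map_poly intr f : {poly R[i]}) z].

(* The default 0 is only reached when z is not algebraic. *)
Definition int_minpoly (R : realType) (z : R[i]) : {poly int} :=
  xget 0 [set f | is_int_minpoly z f].

Definition mahler (R : realType) (z : R[i]) : R :=
  mahler_poly (map_poly intr (int_minpoly z)).

(* Sequences are indexed from 0. *)
Definition Xseq (R : realType) : set (nat -> R[i]) :=
  [set a | (forall n, Qbar_units (a n)) /\ finite_set [set n | a n != 1]].

(* The iterated operators over [set: nat] range over the finitely many indices
   at which the term differs from the neutral element. *)
Definition tau (R : realType) (a : nat -> R[i]) : R[i] :=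
  \big[*%R/1]_(n \in [set: nat]) a n.

Definition tau_fiber (R : realType) (z : R[i]) : set (nat -> R[i]) :=
  [set a | Xseq a /\ tau a = z].

(* Only used for 0 < x; the value at -oo is irrelevant. In the case +oo the set
   of values is finite and nonempty, so that sup is a maximum. *)
Definition mahler_seq (R : realType) (x : \bar R) (a : nat -> R[i]) : R :=
  match x with
  | r%:E => (\sum_(n \in [set: nat]) mahler (a n) `^ r) `^ r^-1
  | +oo%E => sup (range (fun n => mahler (a n)))
  | -oo%E => 0
  end.

Definition metric_mahler (R : realType) (x : \bar R) (z : R[i]) : R :=
  inf [set mahler_seq x a | a in tau_fiber z].

(* Main.v *)
(* Let lambda z be the average of ln |w| over the conjugates w of z, i.e. ln |N z| / d for
   the norm N and degree d of z. Multiplicativity of the norm makes lambda additive, so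
   replacing every term of a sequence with product m in nat by its geometric mean
   exp (lambda z) does not change the product. It does not increase any Mahler measure:
   if f is the minimal polynomial of z, with leading coefficient c, then exp (lambda z) is
   a root of c X^d - |f(0)|, whose Mahler measure is max (ln c) (ln |f(0)|) <= M(z). If
   M(z) < ln 2 then c = |f(0)| = 1, and z is replaced by 1; by Kronecker's theorem this is a
   strict gain unless z is a root of unity. So in a minimizing sequence for x < oo all
   terms other than roots of unity have Mahler measure at least ln 2, and comparison with
   (p^2, 1, 1, ...) leaves room for only one of them in case (i). In case (ii) a single
   such term would have absolute value p^2, hence Mahler measure at least 2 ln p, which is
   beaten by (p, p, 1, ...). *)

Require Import Defs.
From mathcomp Require Import all_boot all_order all_algebra separable.
From mathcomp Require Import all_classical all_reals all_analysis.
From mathcomp Require Import complex.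

Set Implicit Arguments.
Unset Strict Implicit.
Unset Printing Implicit Defensive.

Import Order.TTheory GRing.Theory Num.Theory.

Local Open Scope classical_set_scope.
Local Open Scope ring_scope.
Local Open Scope complex_scope.

(** * Images of the roots of a polynomial under a polynomial map *)

Lemma prodrMl_seq (R : comPzRingType) (I : Type) (s : seq I) (c : R) (G : I -> R) :
  \prod_(i <- s) (c * G i) = c ^+ size s * \prod_(i <- s) G i.
Proof.
elim: s => [|i s IHs]; first by rewrite !big_nil mulr1.
by rewrite !big_cons IHs /= exprS mulrACA.
Qed.

Section HornerMatrix.
Variable F : numClosedFieldType.

Lemma det_horner_mx n (A : 'M[F]_n.+1) (s : seq F) (Q : {poly F}) :
  char_poly A = \prod_(z <- s) ('X - z%:P) ->
  \det (horner_mx A Q) = \prod_(z <- s) Q.[z].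
Proof.
move=> chA.
have sz_s : size s = n.+1.
  by apply: succn_inj; rewrite -(size_char_poly A) chA size_prod_XsubC.
have detA w : \det (A - w%:M) = \prod_(z <- s) (z - w).
  have -> : A - w%:M = - (w%:M - A) by rewrite opprB.
  have -> : w%:M - A = map_mx (horner_eval w) (char_poly_mx A).
    by apply/matrixP=> i j; rewrite !mxE /horner_eval !hornerE hornerMn hornerX.
  rewrite -scaleN1r detZ det_map_mx /= -[\det _]/(char_poly A) chA.
  rewrite /horner_eval horner_prod -sz_s -prodrMl_seq.
  by apply: eq_bigr => z _; rewrite !hornerE mulN1r opprB.
have [t ->] := closed_field_poly_normal Q.
move: (lead_coef Q) => c.
rewrite linearZ rmorph_prod /= detZ.
rewrite (big_morph (@determinant F n.+1) (id1 := 1) (op1 := *%R)); first last.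
- exact: det1.
- by move=> B C; exact: det_mulmx.
under eq_bigr do rewrite rmorphB /= horner_mx_X horner_mx_C detA.
rewrite exchange_big -[X in c ^+ X]sz_s -prodrMl_seq; apply: eq_bigr => z _.
rewrite hornerZ horner_prod; congr (_ * _).
by apply: eq_bigr => w _; rewrite !hornerE.
Qed.

Lemma poly_eq_horner (p q : {poly F}) : (forall x, p.[x] = q.[x]) -> p = q.
Proof.
move=> pq; apply/eqP; rewrite -subr_eq0; apply: contraT => nz.
have := max_poly_roots (rs := mkseq (fun n => n%:R) (size (p - q))) nz.
rewrite size_mkseq ltnn => -> //.
  by apply/allP=> x _; rewrite rootE !hornerE pq subrr.
by rewrite mkseq_uniq // => i j /eqP; rewrite eqr_nat => /eqP.
Qed.

Lemma char_poly_horner_mx n (A : 'M[F]_n.+1) (s : seq F) (P : {poly F}) :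
  char_poly A = \prod_(z <- s) ('X - z%:P) ->
  char_poly (horner_mx A P) = \prod_(z <- s) ('X - P.[z]%:P).
Proof.
move=> chA; apply: poly_eq_horner => x.
have -> : (char_poly (horner_mx A P)).[x] = \det (horner_mx A (x%:P - P)).
  rewrite -[_.[x]]/(horner_eval x (\det _)) -det_map_mx; congr (\det _).
  rewrite [horner_mx A (_ - _)]rmorphB /= horner_mx_C.
  by apply/matrixP=> i j; rewrite !mxE /horner_eval !hornerE hornerMn hornerX.
rewrite (det_horner_mx _ chA) horner_prod.
by apply: eq_bigr => z _; rewrite !hornerE.
Qed.

Lemma exists_poly_image_roots (K : comNzRingType) (f : {rmorphism K -> F})
    (h P : {poly K}) (s : seq F) :
  h \is monic -> map_poly f h = \prod_(z <- s) ('X - z%:P) ->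
  exists2 g : {poly K}, g \is monic &
    map_poly f g = \prod_(z <- s) ('X - (map_poly f P).[z]%:P).
Proof.
move=> mon_h hs.
have sz_h : size h = (size s).+1.
  rewrite -(size_prod_XsubC s id) -hs size_map_poly_id0 //.
  by rewrite (monicP mon_h) rmorph1 oner_eq0.
have [A chA] : exists A : 'M[K]_(size s), char_poly A = h.
  have := companionmxK mon_h; move: (companionmx h); rewrite sz_h /= => A.
  by exists A.
case: s => [|z s] in hs sz_h A chA *.
  by exists 1; rewrite ?monic1 // rmorph1 big_nil.
exists (char_poly (horner_mx A P)); first exact: char_poly_monic.
rewrite map_char_poly map_horner_mx; apply: char_poly_horner_mx.
by rewrite -map_char_poly chA.
Qed.

End HornerMatrix.

Lemma irreducible_dvdp (F E : fieldType) (f : {rmorphism F -> E})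
    (p q : {poly F}) (z : E) :
  irreducible_poly p -> root (map_poly f p) z -> root (map_poly f q) z -> p %| q.
Proof.
move=> irr_p pz qz; apply: contraT => ndiv.
have : coprimep (map_poly f p) (map_poly f q).
  by rewrite coprimep_map irreducible_poly_coprime.
by move/coprimep_root=> /(_ z pz); rewrite (rootP qz) eqxx.
Qed.

Lemma irreducible_root_exists (F E : fieldType) (f : {rmorphism F -> E})
    (q : {poly F}) (z : E) :
  q != 0 -> root (map_poly f q) z ->
  exists2 p, irreducible_poly p & root (map_poly f p) z.
Proof.
move=> nz_q qz.
pose has_size k := `[< exists p : {poly F},
  [/\ p != 0, root (map_poly f p) z & size p = k] >].
have exk : exists k, has_size k by exists (size q); apply/asboolP; exists q.
case: (ex_minnP exk) => _ /asboolP[p [nz_p pz <-]] min_p.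
have {}min_p r : r != 0 -> root (map_poly f r) z -> (size p <= size r)%N.
  by move=> nz_r rz; apply: min_p; apply/asboolP; exists r.
exists p => //; split=> [|r sz_r dv_r].
  rewrite ltnNge; apply/negP => /size1_polyC pC; move: pz nz_p.
  by rewrite pC map_polyC rootC fmorph_eq0 polyC_eq0 => ->.
have [u pE] := dvdpP _ _ dv_r.
have /andP[nz_u nz_r] : (u != 0) && (r != 0) by rewrite -negb_or -mulf_eq0 -pE.
move: pz; rewrite pE rmorphM rootM => /orP[uz|rz].
  have := min_p _ nz_u uz; rewrite pE size_mul // => le_u.
  have : (1 < size r)%N by rewrite ltn_neqAle eq_sym sz_r lt0n size_poly_eq0.
  by move: le_u; rewrite -subn1 leq_subLR addnC leq_add2r ltnNge => ->.
rewrite -dvdp_size_eqp ?dvdp_mull // eqn_leq -pE min_p // andbT.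
exact: dvdp_leq.
Qed.

(* The polynomial with roots s is, up to a constant, a power of p. *)
Lemma sum_roots_irreducible (F E : fieldType) (V : zmodType)
    (f : {rmorphism F -> E}) (phi : E -> V) (p g : {poly F}) (t s : seq E) :
  irreducible_poly p ->
  map_poly f p %= \prod_(w <- t) ('X - w%:P) ->
  map_poly f g %= \prod_(w <- s) ('X - w%:P) ->
  {subset s <= t} ->
  (\sum_(w <- s) phi w) *+ size t = (\sum_(w <- t) phi w) *+ size s.
Proof.
move=> irr_p pt.
have [n] := ubnP (size s); elim: n => // n IHn in g s *.
case: s => [|z s] sz_s gs sub; first by rewrite big_nil mul0rn mulr0n.
have zt : z \in t by apply: sub; rewrite mem_head.
have dv : p %| g.
  apply: (@irreducible_dvdp _ _ f _ _ z irr_p).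
    by rewrite (eqp_root pt) root_prod_XsubC.
  by rewrite (eqp_root gs) root_prod_XsubC mem_head.
have [q qg] := dvdpP _ _ dv.
have : map_poly f q %| \prod_(w <- z :: s) ('X - w%:P).
  by rewrite -(eqp_dvdr _ gs) qg rmorphM dvdp_mulIl.
case/dvdp_prod_XsubC=> m; set u := mask m _ => qu.
have perm_s : perm_eq (z :: s) (u ++ t).
  apply: prod_XsubC_eq; rewrite big_cat /=; apply/eqP.
  rewrite -eqp_monic ?monicMl ?monic_prod_XsubC //.
  by rewrite -(eqp_ltrans gs) qg rmorphM (eqp_trans (eqp_mulr _ qu) (eqp_mull _ pt)).
have sz := perm_size perm_s; rewrite size_cat in sz.
have t_gt0 : (0 < size t)%N by case: (t) zt.
rewrite (perm_big _ perm_s) big_cat /= -/(size (z :: s)) sz mulrnDl mulrnDr.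
congr (_ + _); apply: IHn qu _.
  by rewrite (leq_trans _ (sz_s : size (z :: s) <= n)%N) // sz -addn1 leq_add2l.
by move=> w wu; apply: sub; rewrite (perm_mem perm_s) mem_cat wu.
Qed.

(** * Kronecker's theorem *)

Lemma norm_coef_prod_XsubC_le (F : numDomainType) (s : seq F) i :
  {in s, forall w, `|w| <= 1} ->
  `|(\prod_(w <- s) ('X - w%:P))`_i| <= 2 ^+ size s.
Proof.
elim: s i => [|w s IHs] i sub.
  by rewrite big_nil coef1 expr0; case: (i == 0)%N; rewrite ?normr1 ?normr0 ?ler01.
have {}IHs j : `|(\prod_(w <- s) ('X - w%:P))`_j| <= 2 ^+ size s.
  by apply: IHs => u us; apply: sub; rewrite in_cons us orbT.
rewrite big_cons mulrBl coefB coefXM coefCM /= exprS mulr_natl mulr2n.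
apply: (le_trans (ler_normB _ _)); apply: lerD.
  by case: (i == 0)%N; rewrite ?normr0 ?exprn_ge0 ?ler0n.
by rewrite normrM -[leRHS]mul1r ler_pM // sub ?mem_head.
Qed.

Lemma kronecker (E : numClosedFieldType) (h : {poly int}) (s : seq E) (z : E) :
  h \is monic -> map_poly intr h = \prod_(w <- s) ('X - w%:P) ->
  {in s, forall w, `|w| <= 1} -> z \in s -> z != 0 ->
  exists2 n, (0 < n)%N & z ^+ n = 1.
Proof.
move=> mon_h hs s_le1 zs nz_z.
pose d := size s; pose B := (2 ^ d)%N.
pose decode (c : {ffun 'I_d.+1 -> 'I_B.*2.+1}) : {poly int} :=
  \poly_(i < d.+1) ((c (inord i))%:Z - B%:Z).
pose roots (p : {poly int}) : seq E := sval (closed_field_poly_normal (map_poly intr p)).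
pose T := flatten [seq roots (decode c) | c : {ffun 'I_d.+1 -> 'I_B.*2.+1}].
have mem_T k : z ^+ k \in T.
  have [g mon_g gs] := exists_poly_image_roots 'X^k mon_h hs.
  have sz_g : size g = d.+1.
    rewrite -(size_prod_XsubC s (fun w => (map_poly intr 'X^k).[w])) -gs.
    by rewrite size_map_inj_poly //; exact: intr_inj.
  have g_le i : `|g`_i| <= B%:Z.
    rewrite -(ler_int E) intr_norm -coef_map gs -(big_map _ xpredT (fun w => 'X - w%:P)).
    have -> : (B%:Z)%:~R = 2 ^+ size [seq (map_poly intr 'X^k).[w] | w <- s] :> E.
      by rewrite size_map -pmulrn natrX.
    apply: norm_coef_prod_XsubC_le => _ /mapP[w ws ->].
    by rewrite map_polyXn hornerXn normrX exprn_ile1 // s_le1.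
  have gE : g = decode [ffun i : 'I_d.+1 => inord (absz (g`_i + B%:Z))].
    apply/polyP => i; rewrite coef_poly; case: ltnP => [lt_i|]; last first.
      by move=> le_i; rewrite nth_default // sz_g.
    have := g_le i; rewrite ler_norml => /andP[ge_g le_g].
    have g0 : 0 <= g`_i + B%:Z by rewrite -lerBlDr sub0r.
    rewrite ffunE inordK // inordK ?gez0_abs ?addrK //.
    by rewrite ltnS -lez_nat gez0_abs // -addnn PoszD lerD2r.
  apply/flattenP; exists (roots g).
    by apply/mapP; exists [ffun i : 'I_d.+1 => inord (absz (g`_i + B%:Z))];
      rewrite -?gE ?mem_enum.
  have lead1 : lead_coef (map_poly intr g : {poly E}) = 1.
    by rewrite gs lead_coef_prod_XsubC.
  rewrite /roots; case: closed_field_poly_normal => r /=.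
  rewrite lead1 scale1r => rE; rewrite -root_prod_XsubC -rE gs.
  rewrite -(big_map _ xpredT (fun w => 'X - w%:P)) root_prod_XsubC.
  by apply/mapP; exists z; rewrite // map_polyXn hornerXn.
have /uniqPn : ~~ uniq (mkseq (fun k => z ^+ k) (size T).+1).
  apply/negP => /uniq_leq_size le_T.
  suff /le_T : {subset mkseq (fun k => z ^+ k) (size T).+1 <= T}.
    by rewrite size_mkseq ltnn.
  by move=> _ /mapP[k _ ->].
case/(_ 0) => i [j [lt_ij]]; rewrite size_mkseq => lt_j.
rewrite !nth_mkseq // ?(ltn_trans lt_ij) // => eq_ij.
exists (j - i)%N; first by rewrite subn_gt0.
apply: (mulIf (expf_neq0 i nz_z)).
by rewrite -exprD subnK ?mul1r // ltnW.
Qed.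

Lemma sum_ord_ge1 (R : numDomainType) (F : nat -> R) (N m : nat) : (forall i, 0 <= F i) ->
  (m < N)%N -> F m <= \sum_(i < N) F i.
Proof.
by move=> F_ge0 lt_m; rewrite (bigD1 (Ordinal lt_m)) //= lerDl sumr_ge0.
Qed.

Lemma sum_ord_ge2 (R : numDomainType) (F : nat -> R) (N m n : nat) :
  (forall i, 0 <= F i) ->
  (m < N)%N -> (n < N)%N -> m <> n -> F m + F n <= \sum_(i < N) F i.
Proof.
move=> F_ge0 lt_m lt_n /eqP neq_mn; rewrite (bigD1 (Ordinal lt_m)) //= lerD2l.
rewrite (bigD1 (Ordinal lt_n)) /=; last by rewrite -val_eqE eq_sym.
by rewrite lerDl sumr_ge0.
Qed.

Section MetricMahler.
Variable R : realType.
Implicit Types (z w : R[i]) (f g : {poly R[i]}) (a b : nat -> R[i]).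
Local Notation normc := ComplexField.Normc.normc.
Local Notation ZtoC := (map_poly (intr : int -> R[i])).
Local Notation algebraic := (algebraicOver (ratr : rat -> R[i])).

(** * Mahler measures and minimal polynomials *)

Lemma norm_normcE z : `|z| = (normc z)%:C.
Proof. by []. Qed.

Lemma normc_ge0 z : 0 <= normc z.
Proof. by case: z => a b; exact: sqrtr_ge0. Qed.

Lemma normc_gt0 z : (0 < normc z) = (z != 0).
Proof. by rewrite -normr_gt0 norm_normcE ltcR. Qed.

Lemma normc_real (x : R) : normc x%:C = `|x|.
Proof. by rewrite /normc /= expr0n addr0 sqrtr_sqr. Qed.

Lemma normcX z n : normc (z ^+ n) = normc z ^+ n.
Proof.
elim: n => [|n IHn]; first by rewrite !expr0 ComplexField.Normc.normc1.
by rewrite !exprS ComplexField.Normc.normcM IHn.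
Qed.

Lemma normc_prod (I : Type) (s : seq I) (F : I -> R[i]) :
  normc (\prod_(i <- s) F i) = \prod_(i <- s) normc (F i).
Proof.
exact: (big_morph _ (@ComplexField.Normc.normcM R) (@ComplexField.Normc.normc1 R)).
Qed.

Lemma normc_int (k : int) : normc (k%:~R : R[i]) = `|k|%:~R.
Proof. by rewrite -(rmorph_int (real_complex R)) normc_real intr_norm. Qed.

Lemma log_plus_ge0 (x : R) : 0 <= log_plus x.
Proof. by rewrite /log_plus le_max lexx orbT. Qed.

Lemma crootsE f : f = lead_coef f *: \prod_(w <- croots f) ('X - w%:P).
Proof. exact: (svalP (closed_field_poly_normal f)). Qed.

Lemma mem_croots f w : f != 0 -> (w \in croots f) = root f w.
Proof.
by move=> nz_f; rewrite [in RHS](crootsE f) rootZ ?lead_coef_eq0 // root_prod_XsubC.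
Qed.

Lemma perm_croots c (s : seq R[i]) :
  c != 0 -> perm_eq (croots (c *: \prod_(w <- s) ('X - w%:P))) s.
Proof.
move=> nz_c; apply: prod_XsubC_eq; apply: (scalerI nz_c).
rewrite [RHS]crootsE lead_coefZ.
by rewrite (monicP (monic_prod_XsubC _ _ _)) mulr1.
Qed.

Lemma mahler_polyE c (s : seq R[i]) : c != 0 ->
  mahler_poly (c *: \prod_(w <- s) ('X - w%:P)) =
  ln (normc c) + \sum_(w <- s) log_plus (normc w).
Proof.
move=> nz_c; rewrite /mahler_poly (perm_big _ (perm_croots s nz_c)) lead_coefZ.
by rewrite (monicP (monic_prod_XsubC _ _ _)) mulr1.
Qed.

Lemma mahler_polyM f g : f != 0 -> g != 0 ->
  mahler_poly (f * g) = mahler_poly f + mahler_poly g.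
Proof.
move=> nz_f nz_g; rewrite {1}(crootsE f) {1}(crootsE g) -scalerAl -scalerAr scalerA.
rewrite -big_cat mahler_polyE ?mulf_neq0 ?lead_coef_eq0 // big_cat.
rewrite ComplexField.Normc.normcM lnM ?posrE ?normc_gt0 ?lead_coef_eq0 //.
by rewrite addrACA.
Qed.

Lemma lead_coef_ZtoC (h : {poly int}) : lead_coef (ZtoC h) = (lead_coef h)%:~R.
Proof. by rewrite lead_coef_map_inj //; exact: intr_inj. Qed.

Lemma ZtoC_eq0 (h : {poly int}) : (ZtoC h == 0) = (h == 0).
Proof. by rewrite -!lead_coef_eq0 lead_coef_ZtoC intr_eq0. Qed.

Lemma ln_int_ge0 (k : int) : 0 <= ln (`|k|%:~R : R).
Proof.
have [->|nz_k] := eqVneq k 0; first by rewrite normr0 ln0.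
by rewrite ln_ge0 // ler1z -gtz0_ge1 normr_gt0.
Qed.

Lemma mahler_poly_int_ge0 (h : {poly int}) : 0 <= mahler_poly (ZtoC h).
Proof.
rewrite addr_ge0 // ?sumr_ge0 // => [|w _]; last exact: log_plus_ge0.
by rewrite lead_coef_ZtoC normc_int ln_int_ge0.
Qed.

Lemma mahler_ge0 z : 0 <= mahler z.
Proof. exact: mahler_poly_int_ge0. Qed.

Lemma map_ratr_int (h : {poly int}) :
  map_poly (ratr : rat -> R[i]) (map_poly intr h) = ZtoC h.
Proof. by rewrite -map_poly_comp; apply: eq_map_poly => k /=; rewrite ratr_int. Qed.

Lemma int_minpolyP z :
  algebraic z -> is_int_minpoly z (int_minpoly z).
Proof.
case=> q nz_q qz; apply: (@xgetPex _ 0 [set f | is_int_minpoly z f]).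
have [p irr_p pz] := irreducible_root_exists (f := ratr : {rmorphism rat -> R[i]}) nz_q qz.
have [h [a nz_a pE]] := rat_poly_scale p.
have nz_h : h != 0.
  apply: contraTneq (irredp_neq0 irr_p) => h0.
  by rewrite pE h0 rmorph0 scaler0 eqxx.
have nz_c : ((zcontents h)%:~R : rat) != 0 by rewrite intr_eq0 zcontents_eq0.
have prE : p = (a%:~R^-1 * (zcontents h)%:~R) *: map_poly intr (zprimitive h).
  by rewrite pE {1}[h]zpolyEprim map_polyZ scalerA.
have nz_k : (a%:~R^-1 * (zcontents h)%:~R : rat) != 0.
  by rewrite mulf_neq0 // invr_eq0 intr_eq0.
exists (zprimitive h); split.
- by rewrite zcontents_primitive nz_h.
- case: irr_p => sz_p irr_p; split=> [|r sz_r].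
    by rewrite prE size_scale // in sz_p.
  move=> dv_r; rewrite (eqp_rtrans (_ : _ %= p)).
    by apply: irr_p; rewrite // prE dvdpZr.
  by rewrite prE eqp_sym eqp_scale.
- by move: pz; rewrite prE map_polyZ rootZ ?fmorph_eq0 //= map_ratr_int.
Qed.

Lemma dvdp_int_minpoly z (h : {poly int}) :
  algebraic z -> root (ZtoC h) z ->
  exists r, h = int_minpoly z * r.
Proof.
move=> /int_minpolyP[prim irr fz] hz.
have : map_poly intr (int_minpoly z) %| (map_poly intr h : {poly rat}).
  apply: (irreducible_dvdp (f := ratr : {rmorphism rat -> R[i]}) irr (z := z));
  by rewrite map_ratr_int.
rewrite dvdp_rat_int => /dvdpP_int[r ->]; exists r; congr (_ * _).
by rewrite [in RHS](zpolyEprim (int_minpoly z)) prim scale1r.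
Qed.

Lemma mahler_le_poly z (h : {poly int}) :
  algebraic z -> h != 0 -> root (ZtoC h) z ->
  mahler z <= mahler_poly (ZtoC h).
Proof.
move=> az nz_h /(dvdp_int_minpoly az)[r hE].
move: nz_h; rewrite hE mulf_eq0 negb_or => /andP[nz_f nz_r].
by rewrite rmorphM mahler_polyM ?ZtoC_eq0 // lerDl mahler_poly_int_ge0.
Qed.

(** * Geometric means of conjugates *)

Definition conjugates z : seq R[i] := croots (ZtoC (int_minpoly z)).

Lemma int_minpoly_neq0 z : algebraic z -> int_minpoly z != 0.
Proof.
case/int_minpolyP => + _ _; apply: contra_eq_neq => ->.
by rewrite zcontents0 eq_sym oner_neq0.
Qed.

Lemma lead_int_minpoly_gt0 z : algebraic z -> 0 < lead_coef (int_minpoly z).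
Proof.
by case/int_minpolyP => prim _ _; rewrite -sgz_gt0 -sgz_contents prim.
Qed.

Lemma mem_conjugates z w : algebraic z ->
  (w \in conjugates z) = root (ZtoC (int_minpoly z)) w.
Proof. by move=> az; rewrite mem_croots // ZtoC_eq0 int_minpoly_neq0. Qed.

Lemma conjugates_self z : algebraic z -> z \in conjugates z.
Proof. by move=> az; rewrite mem_conjugates //; case: (int_minpolyP az). Qed.

Lemma root_conjugate z w (q : {poly rat}) : algebraic z -> w \in conjugates z ->
  root (map_poly ratr q) w = root (map_poly ratr q) z.
Proof.
move=> az; rewrite mem_conjugates // => wz; have [_ irr zz] := int_minpolyP az.
rewrite -map_ratr_int in wz zz.
by apply/idP/idP => qw;
   have := (irreducible_dvdp (f := ratr : {rmorphism rat -> R[i]}) irr _ qw);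
   [move/(_ wz)|move/(_ zz)]; rewrite -(dvdp_map (ratr : {rmorphism rat -> R[i]}));
   move/dvdpP=> [r ->]; rewrite rootM ?wz ?zz orbT.
Qed.

Lemma conjugate_neq0 z w : Qbar_units z -> w \in conjugates z -> w != 0.
Proof.
case=> nz_z az wz; have := root_conjugate 'X az wz.
by rewrite map_polyX !rootX (negPf nz_z) => ->.
Qed.

Lemma conjugatesE z : algebraic z ->
  ZtoC (int_minpoly z) =
  (lead_coef (int_minpoly z))%:~R *: \prod_(w <- conjugates z) ('X - w%:P).
Proof. by move=> az; rewrite {1}[LHS]crootsE lead_coef_ZtoC. Qed.

Lemma size_conjugates_gt0 z : algebraic z -> (0 < size (conjugates z))%N.
Proof. by move/conjugates_self; case: conjugates. Qed.

Lemma mahlerE z : algebraic z ->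
  mahler z = ln (lead_coef (int_minpoly z))%:~R +
             \sum_(w <- conjugates z) log_plus (normc w).
Proof.
move=> az; rewrite /mahler /mahler_poly lead_coef_ZtoC normc_int.
by rewrite gtr0_norm // lead_int_minpoly_gt0.
Qed.

Lemma expR_sum_ln (s : seq R[i]) : {in s, forall w, w != 0} ->
  expR (\sum_(w <- s) ln (normc w)) = \prod_(w <- s) normc w.
Proof.
move=> nz_s; rewrite (big_morph _ (@expRD R) (@expR0 R)) big_seq [RHS]big_seq.
by apply: eq_bigr => w /nz_s nz_w; rewrite lnK // posrE normc_gt0.
Qed.

Lemma sum_ln_conjugates z : Qbar_units z ->
  \sum_(w <- conjugates z) ln (normc w) =
  ln (`|(int_minpoly z)`_0|%:~R) - ln (lead_coef (int_minpoly z))%:~R.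
Proof.
move=> uz; have az := uz.2.
set S := \sum_(w <- _) _; set a := lead_coef _.
have a_gt0 : 0 < a%:~R :> R by rewrite ltr0z lead_int_minpoly_gt0.
have -> : `|(int_minpoly z)`_0|%:~R = a%:~R * expR S.
  rewrite -normc_int -coef_map -horner_coef0 (conjugatesE az) hornerZ horner_prod.
  rewrite ComplexField.Normc.normcM normc_int gtr0_norm ?lead_int_minpoly_gt0 //.
  rewrite normc_prod expR_sum_ln => [|w]; last exact: conjugate_neq0.
  congr (_ * _); apply: eq_bigr => w _.
  by rewrite !hornerE normcN.
by rewrite lnM ?posrE ?expR_gt0 // expRK addrAC subrr add0r.
Qed.

Lemma mahler_eq0_root_of_unity z : Qbar_units z -> mahler z = 0 -> is_root_of_unity z.
Proof.
move=> uz /eqP; have az := uz.2; rewrite mahlerE //.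
have lead_gt0 := lead_int_minpoly_gt0 az.
have lead_ge1 : 1 <= (lead_coef (int_minpoly z))%:~R :> R by rewrite ler1z -gtz0_ge1.
rewrite paddr_eq0 ?ln_ge0 ?sumr_ge0 // => [|w _]; last exact: log_plus_ge0.
rewrite ln_eq0 ?(lt_le_trans ltr01) // psumr_eq0 => [|w _]; last exact: log_plus_ge0.
rewrite -[1]/(1%:~R) eqr_int => /andP[/eqP lead1 /allP norm_le].
have mon : int_minpoly z \is monic by rewrite monicE lead1.
have [||n n_gt0 zn] := kronecker mon _ _ (conjugates_self az) uz.1.
- by rewrite conjugatesE // lead1 scale1r.
- move=> w ws; have := norm_le w ws; rewrite /= /log_plus => /eqP lw.
  rewrite norm_normcE -[1]/(1%:C) lecR leNgt; apply/negP => /ln_gt0.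
  by move=> lw_gt0; move: lw; rewrite max_l ?ltW // => lw; rewrite lw ltxx in lw_gt0.
- by exists n => //; rewrite unity_rootE zn.
Qed.

Definition log_geom_mean z : R :=
  (\sum_(w <- conjugates z) ln (normc w)) / (size (conjugates z))%:R.

Lemma size_conjugates_neq0 z : algebraic z -> (size (conjugates z))%:R != 0 :> R.
Proof. by move=> az; rewrite pnatr_eq0 -lt0n size_conjugates_gt0. Qed.

Lemma log_geom_mean_root z (h : {poly rat}) (c : R) :
  algebraic z -> root (map_poly ratr h) z ->
  (forall w, root (map_poly ratr h) w -> normc w = c) ->
  log_geom_mean z = ln c.
Proof.
move=> az hz h_c; rewrite /log_geom_mean.
rewrite big_seq (eq_bigr (fun=> ln c)) => [|w wz]; last first.
  by rewrite (h_c w) // (root_conjugate h az wz).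
rewrite -big_seq big_const_seq count_predT iter_addr_0 -[ln c *+ _]mulr_natr mulfK //.
exact: size_conjugates_neq0.
Qed.

Lemma log_geom_mean_horner (theta z : R[i]) (P : {poly rat}) :
  algebraic theta -> Qbar_units z -> (map_poly ratr P).[theta] = z ->
  \sum_(w <- conjugates theta) ln (normc (map_poly ratr P).[w]) =
  log_geom_mean z * (size (conjugates theta))%:R.
Proof.
move=> atheta uz Pz; have az := uz.2.
pose f : {rmorphism rat -> R[i]} := ratr.
pose q : {poly rat} :=
  (lead_coef (int_minpoly theta))%:~R^-1 *: map_poly intr (int_minpoly theta).
have nz_lead : (lead_coef (int_minpoly theta))%:~R != 0 :> rat.
  by rewrite intr_eq0 lead_coef_eq0 int_minpoly_neq0.
have mon_q : q \is monic.
  by rewrite monicE lead_coefZ lead_coef_map_inj ?mulVf //; exact: intr_inj.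
have qE : map_poly f q = \prod_(w <- conjugates theta) ('X - w%:P).
  rewrite map_polyZ /= map_ratr_int conjugatesE // scalerA.
  rewrite fmorphV /f /= ratr_int mulVf ?scale1r //.
  by rewrite intr_eq0 lead_coef_eq0 int_minpoly_neq0.
have [g mon_g gE] := exists_poly_image_roots P mon_q qE.
have [_ irr_z _] := int_minpolyP az.
have := sum_roots_irreducible (f := f) (fun w => ln (normc w)) irr_z
  (t := conjugates z) (g := g) (s := [seq (map_poly f P).[w] | w <- conjugates theta]).
rewrite !big_map size_map /log_geom_mean => sumE.
apply: (mulIf (size_conjugates_neq0 az)).
rewrite mulrAC mulfVK ?size_conjugates_neq0 // !mulr_natr; apply: sumE.
- rewrite /= map_ratr_int conjugatesE // eqp_scale //.
  by rewrite intr_eq0 lead_coef_eq0 int_minpoly_neq0.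
- by rewrite gE eqpxx.
- move=> _ /mapP[w wt ->]; rewrite mem_conjugates // -map_ratr_int.
  have := root_conjugate (map_poly intr (int_minpoly z) \Po P) atheta wt.
  rewrite !map_comp_poly /root !horner_comp Pz => ->.
  by rewrite map_ratr_int -/(root _ _) -mem_conjugates // conjugates_self.
Qed.

Lemma log_geom_meanM : {in Qbar_units (R := R) &,
  {morph log_geom_mean : x y / x * y >-> x + y}}.
Proof.
move=> x y /set_mem ux /set_mem uy.
have [[nz_x ax] [nz_y ay]] := (ux, uy).
have [qx nz_qx qx0] := ax; have [qy nz_qy qy0] := ay.
have [n [[P Px] [Q Qy]]] := pchar0_PET (iota := ratr : {rmorphism rat -> R[i]})
  nz_qx qx0 nz_qy qy0 (pchar_num _).
set theta := y *+ n - x in Px Qy.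
have atheta : algebraic theta.
  apply: algebraic_sub => //; rewrite -mulr_natr; apply: algebraic_mul => //.
  by rewrite -(rmorph_nat (ratr : {rmorphism rat -> R[i]})); exact: algebraic_id.
have uxy : Qbar_units (x * y).
  by split; [rewrite mulf_neq0|exact: algebraic_mul].
have PQxy : (map_poly ratr (P * Q)).[theta] = x * y by rewrite rmorphM hornerM Px Qy.
apply: (mulIf (size_conjugates_neq0 atheta)).
rewrite mulrDl -(log_geom_mean_horner atheta uxy PQxy).
rewrite -(log_geom_mean_horner atheta ux Px) -(log_geom_mean_horner atheta uy Qy).
rewrite -big_split /= big_seq [RHS]big_seq; apply: eq_bigr => w wt.
have nzw (S : {poly rat}) : (map_poly ratr S).[theta] != 0 -> (map_poly ratr S).[w] != 0.
  by rewrite -!rootE (root_conjugate S atheta wt).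
rewrite rmorphM hornerM ComplexField.Normc.normcM lnM // posrE normc_gt0 nzw //.
  by rewrite Px.
by rewrite Qy.
Qed.

Lemma norm_coef0_int_minpoly_gt0 z : Qbar_units z -> 0 < `|(int_minpoly z)`_0|.
Proof.
move=> uz; rewrite normr_gt0 -(intr_eq0 R[i]) -coef_map -horner_coef0.
rewrite -rootE -mem_conjugates; last exact: uz.2.
by apply/negP => /(conjugate_neq0 uz); rewrite eqxx.
Qed.

Lemma log_geom_mean_eq0 z : Qbar_units z -> mahler z < ln 2 -> log_geom_mean z = 0.
Proof.
move=> uz; have az := uz.2; have lead_gt0 := lead_int_minpoly_gt0 az.
have f0_gt0 := norm_coef0_int_minpoly_gt0 uz.
have small (k : int) : 0 < k -> ln (k%:~R : R) < ln 2 -> k = 1.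
  move=> k_gt0; rewrite ltr_ln ?posrE ?ltr0z // -[2]/(2%:~R) ltr_int.
  by case: k k_gt0 => [[|[|k]]|].
move=> lt_2; rewrite /log_geom_mean sum_ln_conjugates //.
have sum_le : \sum_(w <- conjugates z) ln (normc w) <=
              \sum_(w <- conjugates z) log_plus (normc w).
  by apply: ler_sum => w _; rewrite /log_plus le_max lexx.
have lead1 := small _ lead_gt0; have f01 := small _ f0_gt0.
have m_lead : ln (lead_coef (int_minpoly z))%:~R <= mahler z.
  by rewrite mahlerE // lerDl sumr_ge0 // => w _; exact: log_plus_ge0.
have m_f0 : ln `|(int_minpoly z)`_0|%:~R <= mahler z.
  by rewrite mahlerE // -lerBlDl -sum_ln_conjugates.
rewrite (f01 (le_lt_trans m_f0 lt_2)) (lead1 (le_lt_trans m_lead lt_2)).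
by rewrite subrr mul0r.
Qed.

Definition geom_mean z : R[i] := (expR (log_geom_mean z))%:C.

Lemma geom_mean_neq0 z : geom_mean z != 0.
Proof. by rewrite -normc_gt0 normc_real normr_gt0 gt_eqF ?expR_gt0. Qed.

(* geom_mean z is a root of a X^d - |f(0)|, where f is the minimal polynomial of z, a its
   leading coefficient and d its degree. *)
Lemma geom_mean_mahler z : Qbar_units z ->
  Qbar_units (geom_mean z) /\ mahler (geom_mean z) <= mahler z.
Proof.
move=> uz; have az := uz.2; have lead_gt0 := lead_int_minpoly_gt0 az.
have d_gt0 := size_conjugates_gt0 az; have sumE := sum_ln_conjugates uz.
have b_gt0 := norm_coef0_int_minpoly_gt0 uz.
set d := size (conjugates z) in d_gt0 *.
set a := lead_coef (int_minpoly z) in lead_gt0 sumE *.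
set b := `|(int_minpoly z)`_0| in b_gt0 sumE *.
set S := \sum_(w <- conjugates z) ln (normc w) in sumE.
have aR_gt0 : 0 < a%:~R :> R by rewrite ltr0z.
have bR_gt0 : 0 < b%:~R :> R by rewrite ltr0z.
have nz_d : d%:R != 0 :> R by exact: size_conjugates_neq0.
have meanE : log_geom_mean z * d%:R = S by rewrite /log_geom_mean mulfVK.
have expb : a%:~R * expR (log_geom_mean z) ^+ d = b%:~R.
  rewrite -expRM_natl [d%:R * _]mulrC meanE sumE expRD expRN !lnK ?posrE //.
  by rewrite mulrCA divff ?mulr1 ?gt_eqF.
pose h : {poly int} := a *: 'X^d - b%:P.
have sz_h : size h = d.+1.
  rewrite size_polyDl size_scale ?gt_eqF // size_polyXn //.
  by rewrite size_polyN size_polyC (leq_ltn_trans (leq_b1 _)).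
have lead_h : lead_coef h = a.
  rewrite lead_coefDl ?lead_coefZ ?lead_coefXn ?mulr1 //.
  rewrite size_scale ?gt_eqF // size_polyXn size_polyN size_polyC.
  by rewrite (leq_ltn_trans (leq_b1 _)).
have nz_h : h != 0 by rewrite -size_poly_eq0 sz_h.
have hE w : (ZtoC h).[w] = a%:~R * w ^+ d - b%:~R.
  by rewrite rmorphB /= map_polyZ /= map_polyXn map_polyC /= !hornerE.
have hz : root (ZtoC h) (geom_mean z).
  rewrite rootE hE /geom_mean -rmorphXn -(rmorph_int (real_complex R)) -rmorphM /=.
  by rewrite expb rmorph_int subrr.
have am : algebraic (geom_mean z).
  exists (map_poly intr h); last by rewrite map_ratr_int.
  by rewrite -size_poly_eq0 size_rat_int_poly sz_h.
split; first by split; [exact: geom_mean_neq0|].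
apply: le_trans (mahler_le_poly am nz_h hz) _.
have root_norm w : w \in croots (ZtoC h) -> ln (normc w) = log_geom_mean z.
  rewrite mem_croots ?ZtoC_eq0 // rootE hE subr_eq0 => /eqP/(congr1 (@normc R)).
  rewrite ComplexField.Normc.normcM !normc_int normcX !gtr0_norm //.
  rewrite -expb => /(mulfI (lt0r_neq0 aR_gt0)) e.
  have := eqrXn2 d_gt0 (normc_ge0 w) (expR_ge0 (log_geom_mean z)).
  by rewrite e eqxx => /esym/eqP ->; rewrite expRK.
have sz_croots : size (croots (ZtoC h)) = d.
  have := congr1 (fun p : {poly R[i]} => size p) (crootsE (ZtoC h)).
  rewrite size_scale ?lead_coef_eq0 ?ZtoC_eq0 // size_prod_XsubC.
  by rewrite size_map_inj_poly // ?sz_h => [[]|]; last exact: intr_inj.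
rewrite mahlerE // /mahler_poly lead_coef_ZtoC lead_h normc_int gtr0_norm // lerD2l.
rewrite big_seq (eq_bigr (fun=> Num.max (log_geom_mean z) 0)) => [|w wh]; last first.
  by rewrite /log_plus root_norm.
rewrite -big_seq big_const_seq count_predT iter_addr_0 sz_croots.
rewrite -[_ *+ d]mulr_natr maxr_pMl // mul0r meanE ge_max.
rewrite ler_sum => [|w _]; last by rewrite /log_plus le_max lexx.
by rewrite sumr_ge0 // => w _; exact: log_plus_ge0.
Qed.

(** * Sequences with a given product *)

Lemma Qbar_units_nat (m : nat) : (0 < m)%N -> Qbar_units (m%:R : R[i]).
Proof.
move=> m_gt0; split; first by rewrite pnatr_eq0 -lt0n.
by rewrite -(rmorph_nat (ratr : {rmorphism rat -> R[i]})); exact: algebraic_id.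
Qed.

Lemma Qbar_unitsM z w : Qbar_units z -> Qbar_units w -> Qbar_units (z * w).
Proof.
by move=> [nz_z az] [nz_w aw]; split; [rewrite mulf_neq0|exact: algebraic_mul].
Qed.

Lemma mahler_nat_le (m : nat) : (0 < m)%N -> mahler (m%:R : R[i]) <= ln m%:R.
Proof.
move=> m_gt0; pose h : {poly int} := 'X - (m%:Z)%:P.
have hE : ZtoC h = 1 *: \prod_(w <- [:: m%:R]) ('X - w%:P).
  by rewrite scale1r big_seq1 map_polyXsubC.
have nz_h : h != 0 by rewrite polyXsubC_eq0.
apply: le_trans (mahler_le_poly (Qbar_units_nat m_gt0).2 nz_h _) _.
  by rewrite hE scale1r root_prod_XsubC mem_head.
rewrite hE mahler_polyE ?oner_neq0 // big_seq1 ComplexField.Normc.normc1 ln1 add0r.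
rewrite (_ : normc _ = m%:R) /log_plus ?max_l ?ln_ge0 ?ler1n //.
by rewrite -(rmorph_nat (real_complex R)) normc_real normr_nat.
Qed.

Lemma mahler1 : mahler (1 : R[i]) = 0.
Proof.
apply/eqP; rewrite eq_le mahler_ge0 andbT.
by have := @mahler_nat_le 1 isT; rewrite ln1.
Qed.

Lemma log_plus_le_mahler z : algebraic z -> log_plus (normc z) <= mahler z.
Proof.
move=> az; rewrite mahlerE // (big_rem z) ?conjugates_self //=.
rewrite addrCA lerDl addr_ge0 ?sumr_ge0 // => [|w _]; last exact: log_plus_ge0.
by rewrite ln_ge0 // ler1z -gtz0_ge1 lead_int_minpoly_gt0.
Qed.

Lemma log_geom_mean_nat (m : nat) : (0 < m)%N -> log_geom_mean (m%:R : R[i]) = ln m%:R.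
Proof.
move=> m_gt0; have hE : map_poly (ratr : rat -> R[i]) ('X - (m%:R)%:P) = 'X - (m%:R)%:P.
  rewrite map_polyXsubC; congr (_ - _%:P).
  by rewrite (rmorph_nat (ratr : {rmorphism rat -> R[i]})).
apply: (log_geom_mean_root (Qbar_units_nat m_gt0).2 (h := 'X - (m%:R)%:P)).
  by rewrite hE root_XsubC.
move=> w; rewrite hE root_XsubC => /eqP ->.
by rewrite -(rmorph_nat (real_complex R)) normc_real normr_nat.
Qed.

Lemma normc_root_of_unity z : is_root_of_unity z -> normc z = 1.
Proof.
case=> n n_gt0; rewrite unity_rootE => /eqP/(congr1 (@normc R)).
rewrite normcX ComplexField.Normc.normc1 => /eqP.
by rewrite pexpr_eq1 ?normc_ge0 // => /eqP.
Qed.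

Lemma Xseq_bound a : Xseq a -> exists N, forall n, (N <= n)%N -> a n = 1.
Proof.
case=> _ /finite_seqP[s sE]; exists (\max_(i <- s) i).+1 => n lt_n.
apply/eqP; apply: contraT => an1.
have : [set n | a n != 1] n by [].
rewrite sE /= => ns; have := leq_bigmax_seq n ns isT (F := id).
by rewrite leqNgt lt_n.
Qed.

Lemma Xseq_of_bound a N : (forall n, Qbar_units (a n)) ->
  (forall n, (N <= n)%N -> a n = 1) -> Xseq a.
Proof.
move=> ua aN; split=> //; apply: (sub_finite_set _ (finite_II N)) => n /=.
by apply: contraNltn => /aN ->.
Qed.

Lemma fsbig_nat_bound (V : Type) (idx : V) (op : Monoid.com_law idx)
    (F : nat -> V) N : (forall n, (N <= n)%N -> F n = idx) ->
  \big[op/idx]_(n \in [set: nat]) F n = \big[op/idx]_(n < N) F n.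
Proof.
move=> FN; rewrite fsbig_ord; apply/esym/fsbig_widen => // n [_ /= /negP].
by rewrite -leqNgt => /FN.
Qed.

Lemma tauE a N : (forall n, (N <= n)%N -> a n = 1) -> tau a = \prod_(n < N) a n.
Proof. exact: fsbig_nat_bound. Qed.

Lemma mahler_seqE (r : R) a N : 0 < r -> (forall n, (N <= n)%N -> a n = 1) ->
  mahler_seq r%:E a = (\sum_(n < N) mahler (a n) `^ r) `^ r^-1.
Proof.
move=> r_gt0 aN; rewrite /mahler_seq; congr (_ `^ _).
by apply: fsbig_nat_bound => n /aN ->; rewrite mahler1 powR0 ?gt_eqF.
Qed.

Lemma mahler_le_seq (x : \bar R) a n : (0 < x)%E -> Xseq a ->
  mahler (a n) <= mahler_seq x a.
Proof.
move=> x_gt0 Xa; have [N aN] := Xseq_bound Xa.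
have m_le (F : R -> R) : F 0 = 0 -> (forall y, 0 <= y -> 0 <= F y) ->
    F (mahler (a n)) <= \sum_(i < N) F (mahler (a i)).
  move=> F0 Fge0; have F_ge0 i : 0 <= F (mahler (a i)) by rewrite Fge0 ?mahler_ge0.
  have [lt_n|/aN ->] := ltnP n N; last by rewrite mahler1 F0 sumr_ge0.
  exact: (sum_ord_ge1 (F := fun i => F (mahler (a i)))).
case: x x_gt0 => [r| |//] x_gt0.
  rewrite lte_fin in x_gt0; rewrite (mahler_seqE x_gt0 aN).
  rewrite -[leLHS](powRr1 (mahler_ge0 _)) -(mulfV (lt0r_neq0 x_gt0)) powRrM.
  apply: ge0_ler_powR; rewrite ?nnegrE ?invr_ge0 ?powR_ge0 ?(ltW x_gt0) ?sumr_ge0 //.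
    by move=> i _; exact: powR_ge0.
  by apply: (m_le (fun y => y `^ r)) => [|y _]; rewrite ?powR0 ?gt_eqF ?powR_ge0.
apply: ub_le_sup; last by exists n.
exists (\sum_(i < N) mahler (a i)) => _ [k _ <-].
have [lt_k|/aN ->] := ltnP k N.
  by apply: (sum_ord_ge1 (F := fun i => mahler (a i))) => // i; exact: mahler_ge0.
by rewrite mahler1 sumr_ge0 // => i _; exact: mahler_ge0.
Qed.

Lemma metric_mahler_le (x : \bar R) z a : (0 < x)%E -> tau_fiber z a ->
  metric_mahler x z <= mahler_seq x a.
Proof.
move=> x_gt0 az; apply: ge_inf; last by exists a.
exists 0 => _ [b [Xb _] <-].
exact: le_trans (mahler_ge0 (b 0%N)) (mahler_le_seq _ x_gt0 Xb).
Qed.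

Lemma log_geom_mean_prod a N : (forall n, Qbar_units (a n)) ->
  Qbar_units (\prod_(n < N) a n) /\
  log_geom_mean (\prod_(n < N) a n) = \sum_(n < N) log_geom_mean (a n).
Proof.
move=> ua; elim: N => [|N [uN IHN]].
  rewrite !big_ord0; split; first exact: (@Qbar_units_nat 1).
  by rewrite -[1]/(1%:R) log_geom_mean_nat // ln1.
rewrite !big_ord_recr /=; split; first exact: Qbar_unitsM.
by rewrite log_geom_meanM ?IHN ?inE.
Qed.

Lemma geom_mean_fiber (m : nat) a : (0 < m)%N ->
  tau_fiber m%:R a -> tau_fiber m%:R (fun n => geom_mean (a n)).
Proof.
move=> m_gt0 [Xa am]; have [N aN] := Xseq_bound Xa.
have bN n : (N <= n)%N -> geom_mean (a n) = 1.
  by move=> /aN ->; rewrite /geom_mean -[1 in LHS]/(1%:R) log_geom_mean_nat // ln1 expR0.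
split.
  by apply: Xseq_of_bound bN => n; case: (geom_mean_mahler (Xa.1 n)).
rewrite (tauE bN) /= -rmorph_prod -(big_morph _ (@expRD R) (@expR0 R)).
rewrite -(log_geom_mean_prod N Xa.1).2 -(tauE aN) am log_geom_mean_nat //.
by rewrite lnK ?posrE ?ltr0n // rmorph_nat.
Qed.

Lemma exists_not_root_of_unity z a : tau_fiber z a -> normc z != 1 ->
  exists n, ~ is_root_of_unity (a n).
Proof.
move=> [Xa <-]; have [N aN] := Xseq_bound Xa; rewrite (tauE aN) normc_prod.
apply: contraPP => /forallNP all_rou; apply/negP; rewrite negbK big1 // => i _.
by apply: normc_root_of_unity; exact: contrapT (all_rou i).
Qed.

Lemma minimal_sum_le (r : R) z a b (N : nat) : 0 < r ->
  metric_mahler r%:E z = mahler_seq r%:E a -> tau_fiber z b ->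
  (forall n, (N <= n)%N -> a n = 1) -> (forall n, (N <= n)%N -> b n = 1) ->
  \sum_(n < N) mahler (a n) `^ r <= \sum_(n < N) mahler (b n) `^ r.
Proof.
move=> r_gt0 amin bz aN bN; rewrite leNgt; apply/negP => lt_ba.
have sum_ge0 (c : nat -> R[i]) : \sum_(n < N) mahler (c n) `^ r \is Num.nneg.
  by rewrite nnegrE sumr_ge0 // => i _; exact: powR_ge0.
have rV_gt0 : 0 < r^-1 by rewrite invr_gt0.
have /= := gt0_ltr_powR rV_gt0 (sum_ge0 b) (sum_ge0 a) lt_ba.
rewrite -(mahler_seqE r_gt0 aN) -(mahler_seqE r_gt0 bN) -amin ltNge.
by rewrite metric_mahler_le ?lte_fin.
Qed.

Lemma minimal_mahler_ge (r : R) (m : nat) a n : 0 < r -> (0 < m)%N ->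
  tau_fiber m%:R a -> metric_mahler r%:E m%:R = mahler_seq r%:E a ->
  ~ is_root_of_unity (a n) -> ln 2 <= mahler (a n).
Proof.
move=> r_gt0 m_gt0 am amin nrou; rewrite leNgt; apply/negP => lt2.
have [[ua _] _] := am; have [N aN] := Xseq_bound am.1.
pose b k := geom_mean (a k).
have b1 k : log_geom_mean (a k) = 0 -> b k = 1.
  by rewrite /b /geom_mean => ->; rewrite expR0.
have lt_n : (n < N)%N.
  rewrite ltnNge; apply/negP => /aN an1; apply: nrou; rewrite an1.
  by exists 1%N => //; rewrite unity_rootE expr1n.
have bN k : (N <= k)%N -> b k = 1.
  move=> /aN ak; apply: b1; rewrite ak.
  by rewrite -[1]/(1%:R) log_geom_mean_nat // ln1.
have := minimal_sum_le r_gt0 amin (geom_mean_fiber m_gt0 am) aN bN.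
rewrite leNgt => /negP; apply.
rewrite (bigD1 (Ordinal lt_n)) //= [ltRHS](bigD1 (Ordinal lt_n)) //=.
apply: ltr_leD.
  rewrite -/(b n) b1 ?log_geom_mean_eq0 // mahler1 powR0 ?gt_eqF //.
  rewrite powR_gt0 // lt_neqAle mahler_ge0 andbT eq_sym; apply/eqP => m0.
  by apply: nrou; exact: mahler_eq0_root_of_unity.
apply: ler_sum => i _; apply: ge0_ler_powR; rewrite ?nnegrE ?mahler_ge0 ?(ltW r_gt0) //.
exact: (geom_mean_mahler (ua i)).2.
Qed.

Definition seq2 z w (n : nat) : R[i] := if n == 0%N then z else if n == 1%N then w else 1.

Lemma seq2_bound z w n : (2 <= n)%N -> seq2 z w n = 1.
Proof. by case: n => [|[]]. Qed.

Lemma seq2_fiber z w : Qbar_units z -> Qbar_units w -> tau_fiber (z * w) (seq2 z w).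
Proof.
move=> uz uw; split; last first.
  by rewrite (tauE (@seq2_bound z w)) !big_ord_recl big_ord0 mulr1.
apply: Xseq_of_bound (@seq2_bound z w) => -[|[|n]] //.
exact: (@Qbar_units_nat 1).
Qed.

End MetricMahler.

Theorem theorem1p4 (R : realType) (p : nat) (hp : prime p)
    (x : \bar R) (hx : (0 < x)%E) (a : nat -> R[i])
    (ha : tau_fiber (p%:R ^+ 2) a)
    (hmin : metric_mahler x (p%:R ^+ 2) = mahler_seq x a) :
  ((x * (ln (ln (p%:R ^+ 2)) - ln (ln 2))%:E < (ln 2)%:E)%E ->
    exists! n : nat, ~ is_root_of_unity (a n)) /\
  ((1 < x)%E ->
    exists m n : nat,
      [/\ m <> n, ~ is_root_of_unity (a m) & ~ is_root_of_unity (a n)]).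
Proof.
have p_gt1 := prime_gt1 hp; have p_gt0 := prime_gt0 hp.
have p2_gt0 : (0 < p ^ 2)%N by rewrite expn_gt0 p_gt0.
have p2_gt2 : (2 < p ^ 2)%N by rewrite (@leq_trans (2 ^ 2)%N) // leq_exp2r.
have Xa := ha.1; have [N0 aN0] := Xseq_bound Xa.
pose N := maxn 2 N0.
have aN n : (N <= n)%N -> a n = 1 by rewrite geq_max => /andP[_ /aN0].
have nrou_lt n : ~ is_root_of_unity (a n) -> (n < N)%N.
  move=> nrou; rewrite ltnNge; apply/negP => /aN an1; apply: nrou; rewrite an1.
  by exists 1%N => //; rewrite unity_rootE expr1n.
have seq2N z w n : (N <= n)%N -> seq2 z w n = 1 :> R[i].
  by rewrite geq_max => /andP[le2 _]; exact: seq2_bound.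
have up : Qbar_units (p%:R : R[i]) by exact: Qbar_units_nat.
have u1 : Qbar_units (1 : R[i]) by exact: (@Qbar_units_nat R 1).
have sum_seq2 (r : R) (z w : R[i]) : 0 < r ->
    \sum_(n < N) mahler (seq2 z w n) `^ r = mahler z `^ r + mahler w `^ r.
  move=> r_gt0; rewrite -(subnKC (leq_maxl 2 N0 : (2 <= N)%N)) add2n.
  rewrite !big_ord_recl /= addrA big1 ?addr0 // => i _.
  by rewrite mahler1 powR0 ?gt_eqF.
have norm_p2 : ComplexField.Normc.normc (p%:R ^+ 2 : R[i]) = p%:R ^+ 2.
  by rewrite normcX -(rmorph_nat (real_complex R)) normc_real normr_nat.
have [n0 nrou0] : exists n, ~ is_root_of_unity (a n).
  apply: exists_not_root_of_unity ha _; rewrite norm_p2 -natrX -[1]/(1%:R) eqr_nat.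
  by rewrite gtn_eqF // ltnW.
have ln2_gt0 : 0 < ln (2 : R) by rewrite ln_gt0 // ltr1n.
have lnp_gt0 : 0 < ln (p%:R : R) by rewrite ln_gt0 // ltr1n.
have lnp2 : ln (p%:R ^+ 2 : R) = 2 * ln p%:R.
  by rewrite lnXn ?ltr0n // mulr_natl.
have lnp2_gt : ln 2 < ln (p%:R ^+ 2 : R).
  by rewrite -natrX ltr_ln ?posrE ?ltr0n // ltr_nat.
have lnp2_gt0 := lt_trans ln2_gt0 lnp2_gt.
split=> [small|x_gt1].
  exists n0; split=> // n nrou; apply: contrapT => neq.
  case: x hx hmin small => [r| |//]; last first.
    move=> _ _; rewrite gt0_mulye //.
    by rewrite lte_fin subr_gt0 ltr_ln ?posrE.
  rewrite !lte_fin => r_gt0 hmin small.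
  rewrite -natrX in ha hmin.
  have ge_ln2 k := minimal_mahler_ge (n := k) r_gt0 p2_gt0 ha hmin.
  have fib := seq2_fiber (@Qbar_units_nat R _ p2_gt0) u1; rewrite mulr1 in fib.
  have := minimal_sum_le r_gt0 hmin fib aN (seq2N _ _).
  rewrite sum_seq2 // mahler1 powR0 ?gt_eqF // addr0 leNgt => /negP; apply.
  apply: lt_le_trans (sum_ord_ge2 (F := fun k => mahler (a k) `^ r)
    (fun k => powR_ge0 _ _) (nrou_lt _ nrou0) (nrou_lt _ nrou) neq).
  have pow_ge k : ~ is_root_of_unity (a k) -> ln 2 `^ r <= mahler (a k) `^ r.
    move=> /ge_ln2 le2; apply: ge0_ler_powR; rewrite ?nnegrE ?mahler_ge0 ?(ltW r_gt0) //.
    exact: ltW.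
  apply: lt_le_trans (lerD (pow_ge _ nrou0) (pow_ge _ nrou)).
  apply: (@le_lt_trans _ _ (ln (p%:R ^+ 2) `^ r)).
    apply: ge0_ler_powR; rewrite ?nnegrE ?mahler_ge0 ?(ltW r_gt0) ?(ltW lnp2_gt0) //.
    by rewrite -natrX; exact: mahler_nat_le.
  rewrite -mulr2n -[ltRHS]mulr_natl -ltr_ln ?posrE ?mulr_gt0 ?powR_gt0 //.
  by rewrite [ltRHS]lnM ?posrE ?powR_gt0 // !ln_powR -ltrBlDr -mulrBr.
apply: contrapT => no2.
have rou n : n <> n0 -> is_root_of_unity (a n).
  by move=> neq; apply: contrapT => nrou; apply: no2; exists n, n0.
have norm_n0 : ComplexField.Normc.normc (a n0) = p%:R ^+ 2.
  rewrite -norm_p2 -ha.2 (tauE aN) normc_prod (bigD1 (Ordinal (nrou_lt _ nrou0))) //=.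
  rewrite big1 ?mulr1 // => i; rewrite -val_eqE /= => /eqP neq.
  by apply: normc_root_of_unity; exact: rou.
have m_n0 : 2 * ln p%:R <= mahler (a n0).
  apply: le_trans (log_plus_le_mahler (Xa.1 n0).2).
  by rewrite norm_n0 /log_plus le_max lnp2 lexx.
have fib := seq2_fiber up up; rewrite -expr2 in fib.
case: x hx hmin x_gt1 => [r| |//] x_gt0 hmin x_gt1; last first.
  have := le_trans m_n0 (mahler_le_seq n0 x_gt0 Xa).
  rewrite -hmin leNgt => /negP; apply.
  apply: le_lt_trans (metric_mahler_le x_gt0 fib) _.
  apply: (@le_lt_trans _ _ (ln p%:R)); last by rewrite ltr_pMl ?ltr1n.
  apply: ge_sup; first by exists (mahler (seq2 p%:R p%:R 0)), 0%N.
  move=> _ [n _ <-]; rewrite /seq2.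
  by case: ifP => _; [|case: ifP => _]; rewrite ?mahler1 ?(ltW lnp_gt0) ?mahler_nat_le.
rewrite !lte_fin in x_gt0 x_gt1.
have := minimal_sum_le x_gt0 hmin fib aN (seq2N _ _).
rewrite sum_seq2 // leNgt => /negP; apply.
have mp_le : mahler (p%:R : R[i]) `^ r <= ln p%:R `^ r.
  apply: ge0_ler_powR; rewrite ?nnegrE ?mahler_ge0 ?(ltW x_gt0) ?(ltW lnp_gt0) //.
  exact: mahler_nat_le.
apply: le_lt_trans (lerD mp_le mp_le) _.
have n0_le : (2 * ln p%:R) `^ r <= mahler (a n0) `^ r.
  apply: ge0_ler_powR; rewrite ?nnegrE ?mahler_ge0 ?(ltW x_gt0) //.
  by rewrite mulr_ge0 ?(ltW lnp_gt0).
apply: (@lt_le_trans _ _ (mahler (a n0) `^ r)); last first.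
  exact: (sum_ord_ge1 (F := fun k => mahler (a k) `^ r)
    (fun k => powR_ge0 _ _) (nrou_lt _ nrou0)).
apply: lt_le_trans n0_le; rewrite powRM ?(ltW lnp_gt0) //.
rewrite -mulr2n -[ltLHS]mulr_natl ltr_pM2r ?powR_gt0 //.
rewrite -ltr_ln ?posrE ?powR_gt0 // ln_powR.
by rewrite ltr_pMl.
Qed.
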